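(* Let $\mathbf v\in\mathbb R_{>0}^m$ and let $(\mathcal V,\mathcal W)\in\mathcal{DRS}_{\mathbf v}$ be a local $d_P$-minimizer of the joint potential on $\mathcal{DRS}_{\mathbf v}$, with $\mathcal V=(V_i)_{i=1}^m$. Then: (1) $S_{\mathcal V}$ belongs to the commutant $C_{\mathcal V}=\{A\in M_d(\mathbb C):AV_i^*V_i=V_i^*V_iA\ \forall i\}$; (2) if $\sigma(S_{\mathcal V})=\{\sigma_1,\dots,\sigma_r\}$, then each spectral projection $P_{\sigma_j}$ of $S_{\mathcal V}$ (the orthogonal projection onto $\ker(S_{\mathcal V}-\sigma_jI_d)$) belongs to $C_{\mathcal V}$, for $j=1,\dots,r$.
   Context: Fix integers $m,d\ge1$ and $\mathbf k=(k_1,\dots,k_m)\in\mathbb N^m$ with each $k_i\le d$. A system is an $m$-tuple $\mathcal V=(V_i)_{i=1}^m$ with $V_i\in L(\mathbb C^d,\mathbb C^{k_i})$; its RS operator is $S_{\mathcal V}=\sum_iV_i^*V_i$, and $\mathcal V$ is a reconstruction system (RS) if $S_{\mathcal V}$ is invertible; $\mathcal{RS}(m,\mathbf k,d)$ is the set of RS's. Given weights $\mathbf v\in\mathbb R_{>0}^m$, $\mathcal P_{\mathbf v}(m,\mathbf k,d)$ is the set of RS's with $V_iV_i^*=v_i^2I_{k_i}$ for all $i$. $\mathcal W\in\mathcal{RS}$ is a dual of $\mathcal V$ if $\sum_iW_i^*V_i=I_d$, and $\mathcal D(\mathcal V)$ is the set of duals. $\mathcal{DRS}_{\mathbf v}=\{(\mathcal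 V,\mathcal W)\in\mathcal P_{\mathbf v}\times\mathcal{RS}(m,\mathbf k,d):\mathcal W\in\mathcal D(\mathcal V)\}$, joint potential $\mathrm{FP}(\mathcal V,\mathcal W)=\operatorname{tr}S_{\mathcal V}^2+\operatorname{tr}S_{\mathcal W}^2$. The metric $d_P(\mathcal V,\mathcal W)=(\sum_i\|V_i-W_i\|_2^2)^{1/2}$ uses the Frobenius norm. A pair in $\mathcal{DRS}_{\mathbf v}$ is a local $d_P$-minimizer of FP if there is $\varepsilon>0$ with $\mathrm{FP}(\mathcal V',\mathcal W')\ge\mathrm{FP}(\mathcal V,\mathcal W)$ for all $(\mathcal V',\mathcal W')\in\mathcal{DRS}_{\mathbf v}$ with $d_P(\mathcal V,\mathcal V')+d_P(\mathcal W,\mathcal W')<\varepsilon$. *)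

(* Defs.v *)
From HB Require Import structures.
From mathcomp Require Import all_boot all_order all_algebra.
Set Implicit Arguments. Unset Strict Implicit. Unset Printing Implicit Defensive.
Import Order.TTheory GRing.Theory Num.Theory.
Local Open Scope ring_scope.

Section Defs.
Variable C : numClosedFieldType.

Definition adjmx (p q : nat) (A : 'M[C]_(p, q)) : 'M[C]_(q, p) :=
  (map_mx Num.conj A)^T.

(* a system: V_i in L(C^d, C^{k_i}) *)
Definition system (m d : nat) (k : 'I_m -> nat) := forall i : 'I_m, 'M[C]_(k i, d).
Arguments system : clear implicits.

Definition RSop m d k (V : system m d k) : 'M[C]_d :=
  \sum_(i < m) adjmx (V i) *m V i.

Definition is_RS m d k (V : system m d k) : Prop := RSop V \in unitmx.

Definition in_Pv m d k (v : 'I_m -> C) (V : system m d k) : Prop :=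
  is_RS V /\ forall i : 'I_m, V i *m adjmx (V i) = (v i ^+ 2)%:M.

Definition is_dual m d k (V W : system m d k) : Prop :=
  is_RS W /\ \sum_(i < m) adjmx (W i) *m V i = 1%:M.

Definition in_DRS m d k (v : 'I_m -> C) (V W : system m d k) : Prop :=
  in_Pv v V /\ is_dual V W.

Definition FP m d k (V W : system m d k) : C :=
  \tr (RSop V ^+ 2) + \tr (RSop W ^+ 2).

Definition frob2 (p q : nat) (A : 'M[C]_(p, q)) : C :=
  \sum_(a < p) \sum_(b < q) `|A a b| ^+ 2.

Definition dP m d k (V W : system m d k) : C :=
  sqrtC (\sum_(i < m) frob2 (V i - W i)).

Definition local_min_FP m d k (v : 'I_m -> C) (V W : system m d k) : Prop :=
  in_DRS v V W /\
  exists eps : C, 0 < eps /\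
    forall V' W' : system m d k, in_DRS v V' W' ->
      dP V V' + dP W W' < eps -> FP V W <= FP V' W'.

Definition in_commutant m d k (V : system m d k) (A : 'M[C]_d) : Prop :=
  forall i : 'I_m, A *m (adjmx (V i) *m V i) = (adjmx (V i) *m V i) *m A.

Definition orth_proj_onto_ker (n : nat) (M P : 'M[C]_n) : Prop :=
  P *m P = P /\ adjmx P = P /\
  forall x : 'cV[C]_n, M *m x = 0 <-> P *m x = x.

End Defs.
Arguments system : clear implicits.

(* Main.v *)
Require Import Defs.
From HB Require Import structures.
From mathcomp Require Import all_boot all_order all_algebra.
Set Implicit Arguments. Unset Strict Implicit. Unset Printing Implicit Defensive.
Import Order.TTheory GRing.Theory Num.Theory.
Local Open Scope ring_scope.

(** Write [S] for the RS operator of [V] and [P_i = V_i^* V_i].  For fixed [V]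
    the potential is strictly convex in the dual, so a local minimizer has [W]
    equal to the canonical dual [V_i S^-1], whose RS operator is [S^-1].  Moving
    [V_i] to [V_i U_i] with [U_i] unitary close to [1], and [W] along with the
    canonical dual, stays in the constraint set; stationarity of
    [tr S^2 + tr S^-2] then says that [S - S^-3] commutes with every [P_i].
    Since [x - x^-3] is strictly increasing on [x > 0], so does [S], and hence
    every spectral projection of [S].  The last monotonicity step is done with
    traces, without diagonalizing [S]. *)

(** * Adjoints, the Frobenius norm and trace identities for RS operators *)

Section Adjoint.
Variable C : numClosedFieldType.

Lemma adjmxE p q (A : 'M[C]_(p, q)) i j : adjmx A i j = (A j i)^*.
Proof. by rewrite !mxE. Qed.

Lemma adjmxK p q (A : 'M[C]_(p, q)) : adjmx (adjmx A) = A.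
Proof. by apply/matrixP=> i j; rewrite !adjmxE conjCK. Qed.

Lemma adjmxD p q (A B : 'M[C]_(p, q)) : adjmx (A + B) = adjmx A + adjmx B.
Proof. by rewrite /adjmx raddfD/= raddfD. Qed.

Lemma adjmxN p q (A : 'M[C]_(p, q)) : adjmx (- A) = - adjmx A.
Proof. by rewrite /adjmx raddfN/= raddfN. Qed.

Lemma adjmx0 p q : adjmx (0 : 'M[C]_(p, q)) = 0.
Proof. by rewrite /adjmx raddf0/= raddf0. Qed.

Lemma adjmx1 n : adjmx (1%:M : 'M[C]_n) = 1%:M.
Proof. by rewrite /adjmx map_mx1 trmx1. Qed.

Lemma adjmxZ p q c (A : 'M[C]_(p, q)) : adjmx (c *: A) = c^* *: adjmx A.
Proof. by rewrite /adjmx map_mxZ linearZ. Qed.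

Lemma adjmxM p q r (A : 'M[C]_(p, q)) (B : 'M[C]_(q, r)) :
  adjmx (A *m B) = adjmx B *m adjmx A.
Proof. by rewrite /adjmx map_mxM trmx_mul. Qed.

Lemma adjmx_sum p q (I : Type) (s : seq I) (F : I -> 'M[C]_(p, q)) :
  adjmx (\sum_(i <- s) F i) = \sum_(i <- s) adjmx (F i).
Proof. exact: (big_morph _ (@adjmxD p q) (@adjmx0 p q)). Qed.

Lemma adjmx_inv n (A : 'M[C]_n) : adjmx (invmx A) = invmx (adjmx A).
Proof. by rewrite /adjmx map_invmx trmx_inv. Qed.

Lemma frob2_ge0 p q (A : 'M[C]_(p, q)) : 0 <= frob2 A.
Proof. by do 2!apply: sumr_ge0 => ? _; rewrite exprn_ge0. Qed.

Lemma frob2_eq0 p q (A : 'M[C]_(p, q)) : frob2 A = 0 -> A = 0.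
Proof.
move=> A0; apply/matrixP=> i j; rewrite mxE; apply/eqP.
have row0 : forall a, \sum_b `|A a b| ^+ 2 = 0.
  move=> a; apply: (psumr_eq0P _ A0) => // b _.
  by apply: sumr_ge0 => ? _; rewrite exprn_ge0.
have := psumr_eq0P (fun b _ => exprn_ge0 2 (normr_ge0 (A i b))) (row0 i).
by move=> /(_ j isT)/eqP; rewrite expf_eq0 normr_eq0.
Qed.

Lemma mxtrace_mul_adj p q (A : 'M[C]_(p, q)) : \tr (A *m adjmx A) = frob2 A.
Proof.
apply: eq_bigr => i _; rewrite mxE; apply: eq_bigr => j _.
by rewrite adjmxE normCK.
Qed.

Lemma RSop_adj m d k (V : system C m d k) : adjmx (RSop V) = RSop V.
Proof.
by rewrite adjmx_sum; apply: eq_bigr => i _; rewrite adjmxM adjmxK.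
Qed.

Lemma mxtrace_RSop_mul m d k p (V : system C m d k) (A : 'M[C]_(d, p)) :
  \tr (adjmx A *m RSop V *m A) = \sum_(i < m) frob2 (V i *m A).
Proof.
rewrite mulmx_sumr mulmx_suml raddf_sum; apply: eq_bigr => i _ /=.
by rewrite -mxtrace_mul_adj adjmxM [RHS]mxtrace_mulC !mulmxA.
Qed.

(* Both sandwiching operators are positive, so the trace is a sum of squared norms. *)
Lemma mxtrace_RSop_conj m d k m' d' k' (V : system C m d k)
    (W : system C m' d' k') (A : 'M[C]_(d, d')) :
  \tr (adjmx A *m RSop V *m A *m RSop W) =
  \sum_(j < m') \sum_(i < m) frob2 (V i *m A *m adjmx (W j)).
Proof.
rewrite {2}/RSop mulmx_sumr raddf_sum; apply: eq_bigr => j _ /=.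
rewrite mulmxA mxtrace_mulC; under eq_bigr do rewrite -mulmxA.
by rewrite -mxtrace_RSop_mul adjmxM adjmxK !mulmxA.
Qed.

End Adjoint.

(** * First-order expansions in a small positive parameter *)

Section Jets.
Variable C : numClosedFieldType.

(** A one-sided germ at 0. One side is enough, because minimality is only tested against curves that
    leave the minimizer in a descent direction. *)
Definition near0 (P : C -> Prop) : Prop :=
  exists2 e : C, 0 < e & forall t, 0 < t -> t < e -> P t.

Lemma near0_and P Q : near0 P -> near0 Q -> near0 (fun t => P t /\ Q t).
Proof.
(* The order on [C] is partial, but positive elements are real and hence comparable. *)
move=> [e e0 Pe] [f f0 Qf]; exists (Num.min e f).
  by case: (real_leP (gtr0_real e0) (gtr0_real f0)).
move=> t t0; case: (real_leP (gtr0_real e0) (gtr0_real f0)) => ef tl.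
  by split; [apply: Pe | apply: Qf => //; exact: lt_le_trans ef].
by split; [apply: Pe => //; exact: lt_trans ef | apply: Qf].
Qed.

Lemma near0_lt (P : C -> Prop) e :
  0 < e -> (forall t, 0 < t -> t < e -> P t) -> near0 P.
Proof. by exists e. Qed.

Lemma near0_imp (P Q : C -> Prop) :
  (forall t, 0 < t -> P t -> Q t) -> near0 P -> near0 Q.
Proof. by move=> PQ [e e0 Pe]; exists e => // t t0 te; apply/PQ/Pe. Qed.

Lemma near0_all (P : C -> Prop) : (forall t, 0 < t -> P t) -> near0 P.
Proof. by move=> PT; exists 1 => // t t0 _; apply: PT. Qed.

Lemma near0_ex (P : C -> Prop) : near0 P -> exists2 t, 0 < t & P t.
Proof.
move=> [e e0 Pe]; exists (e / 2); first by rewrite divr_gt0.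
by apply: Pe; rewrite ?divr_gt0// ltr_pdivrMr// ltr_pMr// ltr1n.
Qed.

Lemma near0_mul_lt (M e : C) : 0 <= M -> 0 < e -> near0 (fun t => t * M < e).
Proof.
move=> M0 e0; have M1 : 0 < M + 1 by rewrite ltr_wpDl.
(* Dividing by [M + 1] rather than [M] also covers [M = 0]. *)
apply: (@near0_lt _ (e / (M + 1))) => [|t t0]; first by rewrite divr_gt0.
rewrite ltr_pdivlMr// => /(le_lt_trans _)-> //.
by rewrite ler_pM2l// lerDl.
Qed.

Lemma near0_forall_ord m (P : 'I_m -> C -> Prop) :
  (forall i, near0 (P i)) -> near0 (fun t => forall i, P i t).
Proof.
move=> nP; suff [e e0 He]: near0 (fun t => forall i, i \in enum 'I_m -> P i t).
  by exists e => // t t0 te i; apply: (He t) => //; rewrite mem_enum.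
elim: (enum 'I_m) => [|i s IH]; first exact: near0_all.
apply: near0_imp (near0_and (nP i) IH) => t _ [Pi Ps] j.
by rewrite inE => /predU1P[->|/Ps].
Qed.

(** The entrywise l1 norm is submultiplicative across rectangular shapes, involves no square root,
    and dominates both the trace and the Frobenius norm. *)
Definition mxnorm1 p q (A : 'M[C]_(p, q)) : C := \sum_i \sum_j `|A i j|.

Lemma mxnorm1_ge0 p q (A : 'M[C]_(p, q)) : 0 <= mxnorm1 A.
Proof. by do 2!apply: sumr_ge0 => ? _. Qed.

Lemma mxnorm1_eq0 p q (A : 'M[C]_(p, q)) : mxnorm1 A = 0 -> A = 0.
Proof.
move=> A0; apply/matrixP=> i j; rewrite mxE; apply/eqP/normr0P.
have row0 a : \sum_b `|A a b| = 0.
  by apply: (psumr_eq0P _ A0) => // b _; apply: sumr_ge0.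
exact: (psumr_eq0P (fun b _ => normr_ge0 (A i b)) (row0 i)).
Qed.

Lemma mxnorm1D p q (A B : 'M[C]_(p, q)) : mxnorm1 (A + B) <= mxnorm1 A + mxnorm1 B.
Proof.
rewrite -big_split ler_sum// => i _; rewrite -big_split ler_sum// => j _.
by rewrite mxE ler_normD.
Qed.

Lemma mxnorm1Z p q c (A : 'M[C]_(p, q)) : mxnorm1 (c *: A) = `|c| * mxnorm1 A.
Proof.
rewrite mulr_sumr; apply: eq_bigr => i _; rewrite mulr_sumr.
by apply: eq_bigr => j _; rewrite mxE normrM.
Qed.

Lemma mxnorm1_adj p q (A : 'M[C]_(p, q)) : mxnorm1 (adjmx A) = mxnorm1 A.
Proof.
rewrite /mxnorm1 exchange_big; apply: eq_bigr => i _; apply: eq_bigr => j _.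
by rewrite adjmxE norm_conjC.
Qed.

Lemma mxnorm1M p q r (A : 'M[C]_(p, q)) (B : 'M[C]_(q, r)) :
  mxnorm1 (A *m B) <= mxnorm1 A * mxnorm1 B.
Proof.
rewrite mulr_suml ler_sum// => i _.
apply: (@le_trans _ _ (\sum_j \sum_l `|A i l| * `|B l j|)).
  apply: ler_sum => j _; rewrite mxE; apply: le_trans (ler_norm_sum _ _ _) _.
  by apply: ler_sum => l _; rewrite normrM.
rewrite exchange_big mulr_suml ler_sum// => l _ /=; rewrite -mulr_sumr.
(* Row [l] of [B] contributes only a part of the norm of [B]. *)
rewrite ler_wpM2l// /mxnorm1 (bigD1 l)//= lerDl.
by do 2!apply: sumr_ge0 => ? _.
Qed.

Lemma norm_mxtrace_le n (A : 'M[C]_n) : `|\tr A| <= mxnorm1 A.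
Proof.
apply: le_trans (ler_norm_sum _ _ _) _; apply: ler_sum => i _.
by rewrite (bigD1 i)//= lerDl sumr_ge0.
Qed.

Lemma sqr_sum_ge (I : Type) (s : seq I) (F : I -> C) :
  (forall i, 0 <= F i) -> \sum_(i <- s) F i ^+ 2 <= (\sum_(i <- s) F i) ^+ 2.
Proof.
move=> F0; elim: s => [|i s IH]; first by rewrite !big_nil expr0n.
rewrite !big_cons sqrrD -addrA lerD2l (le_trans IH)// lerDr.
by rewrite mulrn_wge0// mulr_ge0// sumr_ge0.
Qed.

Lemma frob2_le p q (A : 'M[C]_(p, q)) : frob2 A <= mxnorm1 A ^+ 2.
Proof.
apply: le_trans (sqr_sum_ge _ _); last by move=> i; apply: sumr_ge0.
by apply: ler_sum => i _; apply: sqr_sum_ge.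
Qed.

Lemma dP_le m d k (V W : system C m d k) :
  dP V W <= \sum_(i < m) mxnorm1 (V i - W i).
Proof.
have s0 : 0 <= \sum_(i < m) mxnorm1 (V i - W i).
  by apply: sumr_ge0 => i _; apply: mxnorm1_ge0.
rewrite /dP -(sqrCK s0) ler_sqrtC ?qualifE/= ?exprn_ge0//; last first.
  by apply: sumr_ge0 => i _; apply: frob2_ge0.
apply: le_trans (sqr_sum_ge _ _) => [|i]; last exact: mxnorm1_ge0.
by apply: ler_sum => i _; apply: frob2_le.
Qed.

Definition bounded0 p q (A : C -> 'M[C]_(p, q)) : Prop :=
  exists2 M : C, 0 <= M & near0 (fun t => mxnorm1 (A t) <= M).

Lemma bounded0_cst p q (A : 'M[C]_(p, q)) : bounded0 (fun=> A).
Proof. by exists (mxnorm1 A); [apply: mxnorm1_ge0 | apply: near0_all]. Qed.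

Lemma bounded0D p q (A B : C -> 'M[C]_(p, q)) :
  bounded0 A -> bounded0 B -> bounded0 (fun t => A t + B t).
Proof.
move=> [M M0 AM] [N N0 BN]; exists (M + N); first exact: addr_ge0.
apply: near0_imp (near0_and AM BN) => t _ [At Bt].
by apply: le_trans (mxnorm1D _ _) _; apply: lerD.
Qed.

Lemma bounded0M p q r (A : C -> 'M[C]_(p, q)) (B : C -> 'M[C]_(q, r)) :
  bounded0 A -> bounded0 B -> bounded0 (fun t => A t *m B t).
Proof.
move=> [M M0 AM] [N N0 BN]; exists (M * N); first exact: mulr_ge0.
apply: near0_imp (near0_and AM BN) => t _ [At Bt].
by apply: le_trans (mxnorm1M _ _) _; apply: ler_pM; rewrite ?mxnorm1_ge0.
Qed.

Lemma bounded0_adj p q (A : C -> 'M[C]_(p, q)) :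
  bounded0 A -> bounded0 (fun t => adjmx (A t)).
Proof.
move=> [M M0 AM]; exists M => //.
by apply: near0_imp AM => t _; rewrite mxnorm1_adj.
Qed.

Lemma bounded0N p q (A : C -> 'M[C]_(p, q)) :
  bounded0 A -> bounded0 (fun t => - A t).
Proof.
move=> [M M0 AM]; exists M => //; apply: near0_imp AM => t _.
by rewrite -scaleN1r mxnorm1Z normrN1 mul1r.
Qed.

Lemma bounded0Z p q (A : C -> 'M[C]_(p, q)) :
  bounded0 A -> bounded0 (fun t => t *: A t).
Proof.
move=> [M M0 AM]; exists M => //.
apply: near0_imp (near0_and AM (near0_mul_lt ler01 ltr01)) => t t0 [At].
rewrite mulr1 => t1; rewrite mxnorm1Z (gtr0_norm t0).
by apply: le_trans At; rewrite ler_piMl ?mxnorm1_ge0// ltW.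
Qed.

(* [A t = A0 + t A1 + O(t^2)] for small [t > 0]; in the partially ordered
   field [C] the condition [0 < t] also makes [t] real, so jets pass to adjoints. *)
Definition jet p q (A : C -> 'M[C]_(p, q)) (A0 A1 : 'M[C]_(p, q)) : Prop :=
  exists2 R : C -> 'M[C]_(p, q), bounded0 R &
    near0 (fun t => A t = A0 + t *: (A1 + t *: R t)).

Lemma jet_lin p q (A B : 'M[C]_(p, q)) : jet (fun t => A + t *: B) A B.
Proof.
exists (fun=> 0); first exact: bounded0_cst.
by apply: near0_all => t _; rewrite scaler0 addr0.
Qed.

Lemma jet_cst p q (A : 'M[C]_(p, q)) : jet (fun=> A) A 0.
Proof.
exists (fun=> 0); first exact: bounded0_cst.
by apply: near0_all => t _; rewrite scaler0 addr0 scaler0 addr0.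
Qed.

Lemma jetD p q (A B : C -> 'M[C]_(p, q)) A0 A1 B0 B1 :
  jet A A0 A1 -> jet B B0 B1 -> jet (fun t => A t + B t) (A0 + B0) (A1 + B1).
Proof.
move=> [R bR AE] [T bT BE]; exists (fun t => R t + T t); first exact: bounded0D.
apply: near0_imp (near0_and AE BE) => t _ [-> ->].
by rewrite addrACA -scalerDr [A1 + t *: _ + _]addrACA -scalerDr.
Qed.

Lemma jet_sum p q (I : Type) (s : seq I) (A : I -> C -> 'M[C]_(p, q)) A0 A1 :
  (forall i, jet (A i) (A0 i) (A1 i)) ->
  jet (fun t => \sum_(i <- s) A i t) (\sum_(i <- s) A0 i) (\sum_(i <- s) A1 i).
Proof.
move=> jA; elim: s => [|i s IH].
  rewrite !big_nil; have [R bR RE] := jet_cst (0 : 'M[C]_(p, q)).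
  by exists R => //; apply: near0_imp RE => t _ {1}->; rewrite big_nil.
rewrite !big_cons; have [R bR RE] := jetD (jA i) IH.
by exists R => //; apply: near0_imp RE => t _; rewrite big_cons.
Qed.

Lemma jetM p q r (A : C -> 'M[C]_(p, q)) (B : C -> 'M[C]_(q, r)) A0 A1 B0 B1 :
  jet A A0 A1 -> jet B B0 B1 ->
  jet (fun t => A t *m B t) (A0 *m B0) (A1 *m B0 + A0 *m B1).
Proof.
move=> [R bR AE] [T bT BE].
(* Everything of order at least two in [(A0 + t X) (B0 + t Y)], divided by [t ^+ 2], with [X] and
   [Y] as set below. *)
exists (fun t => R t *m B0 + ((A1 + t *: R t) *m (B1 + t *: T t) + A0 *m T t)).
  by do ![apply: bounded0D | apply: bounded0M | apply: bounded0Z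
         | apply: bounded0_cst].
apply: near0_imp (near0_and AE BE) => t _ [-> ->].
set X := A1 + t *: R t; set Y := B1 + t *: T t.
have XE : X *m B0 = A1 *m B0 + t *: (R t *m B0) by rewrite mulmxDl scalemxAl.
have YE : A0 *m Y = A0 *m B1 + t *: (A0 *m T t) by rewrite mulmxDr scalemxAr.
rewrite mulmxDl [A0 *m _]mulmxDr [t *: X *m _]mulmxDr -!scalemxAl -!scalemxAr.
rewrite -addrA -!scalerDr XE YE; congr (_ + t *: _).
rewrite !scalerDr -[_ + _ + t *: (X *m Y)]addrA addrACA.
by congr (_ + _); rewrite addrC// -addrA.
Qed.

Lemma jet_adj p q (A : C -> 'M[C]_(p, q)) A0 A1 :
  jet A A0 A1 -> jet (fun t => adjmx (A t)) (adjmx A0) (adjmx A1).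
Proof.
move=> [R bR AE]; exists (fun t => adjmx (R t)); first exact: bounded0_adj.
apply: near0_imp AE => t t0 ->.
by rewrite !(adjmxD, adjmxZ) conj_Creal ?gtr0_real.
Qed.

Lemma jet_eq p q (A B : C -> 'M[C]_(p, q)) A0 A1 :
  near0 (fun t => B t = A t) -> jet A A0 A1 -> jet B A0 A1.
Proof.
move=> BA [R bR AE]; exists R => //.
by apply: near0_imp (near0_and BA AE) => t _ [-> ->].
Qed.

Lemma jet_lip p q (A : C -> 'M[C]_(p, q)) A0 A1 : jet A A0 A1 ->
  exists2 M, 0 <= M & near0 (fun t => mxnorm1 (A0 - A t) <= t * M).
Proof.
move=> [R bR AE].
have [M M0 LM] := bounded0D (bounded0_cst A1) (bounded0Z bR).
exists M => //; apply: near0_imp (near0_and AE LM) => t t0 [-> LMt].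
rewrite opprD addNKr -scaleNr mxnorm1Z normrN gtr0_norm//.
by rewrite ler_wpM2l// ltW.
Qed.

(** A Neumann-type argument without series. Once [J *m (A0 - A t)] has norm at most 1/2, a matrix
    killed by [A t] is bounded by half its own norm, so it vanishes. The identity
    [A^-1 = J + J (A0 - A) A^-1] then bounds the inverse by twice the norm of [J]. *)
Lemma bounded0_inv n (A : C -> 'M[C]_n) A0 A1 : jet A A0 A1 ->
  A0 \in unitmx ->
  near0 (fun t => A t \in unitmx) /\ bounded0 (fun t => invmx (A t)).
Proof.
move=> jA uA; have [M M0 AM] := jet_lip jA.
set J := invmx A0; pose N := mxnorm1 J * M.
have N0 : 0 <= N by rewrite mulr_ge0 ?mxnorm1_ge0.
have h0 : 0 < 2^-1 :> C by rewrite invr_gt0.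
have near_half : near0 (fun t => mxnorm1 (J *m (A0 - A t)) <= 2^-1).
  apply: near0_imp (near0_and AM (near0_mul_lt N0 h0)) => t t0 [At tN].
  apply: le_trans (mxnorm1M _ _) _; apply: le_trans (ltW tN).
  by rewrite /N mulrCA ler_wpM2l ?mxnorm1_ge0.
have uAt : near0 (fun t => A t \in unitmx).
  apply: near0_imp near_half => t t0 Jt.
  (* [kermx] is a left kernel; transposing makes its rows into columns killed by [A t]. *)
  rewrite -unitmx_tr -row_free_unit -kermx_eq0; apply/eqP.
  rewrite -[LHS]trmxK; set K := kermx _; apply/eqP; rewrite trmx_eq0; apply/eqP.
  apply: mxnorm1_eq0; apply/eqP; rewrite eq_le mxnorm1_ge0 andbT.
  have AK : A t *m K^T = 0.
    by apply: trmx_inj; rewrite trmx_mul trmxK mulmx_ker trmx0.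
  have KE : K^T = J *m (A0 - A t) *m K^T.
    by rewrite -mulmxA mulmxBl AK subr0 mulKmx.
  have : mxnorm1 K^T <= 2^-1 * mxnorm1 K^T.
    rewrite {1}KE; apply: le_trans (mxnorm1M _ _) _.
    by rewrite ler_wpM2r ?mxnorm1_ge0.
  by rewrite ler_pdivlMl// mulr_natl mulr2n gerDl.
split=> //; exists (2 * mxnorm1 J); first by rewrite mulr_ge0 ?mxnorm1_ge0.
apply: near0_imp (near0_and uAt near_half) => t t0 [ut Jt].
have BE : invmx (A t) = J + J *m (A0 - A t) *m invmx (A t).
  by rewrite -mulmxA mulmxBl mulmxBr mulmxV// mulmx1 mulKmx// addrC subrK.
rewrite -ler_pdivrMl//.
have : mxnorm1 (invmx (A t)) <= mxnorm1 J + 2^-1 * mxnorm1 (invmx (A t)).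
  rewrite {1}BE; apply: le_trans (mxnorm1D _ _) _; rewrite lerD2l.
  apply: le_trans (mxnorm1M _ _) _.
  by rewrite ler_wpM2r ?mxnorm1_ge0.
rewrite -lerBlDr; apply: le_trans; set x := mxnorm1 _.
by rewrite lerBrDr -mulrDl -[2^-1]div1r -splitr mul1r.
Qed.

(** Writing [L] for the difference quotient of [A], the inverse [B] satisfies [B = J - t J L B].
    Substituting this identity into itself once exposes the linear term; what is left is bounded by
    [bounded0_inv]. *)
Lemma jet_inv n (A : C -> 'M[C]_n) A0 A1 : jet A A0 A1 -> A0 \in unitmx ->
  jet (fun t => invmx (A t)) (invmx A0) (- (invmx A0 *m A1 *m invmx A0)).
Proof.
move=> jA uA; have [uAt bB] := bounded0_inv jA uA.
move: jA => [R bR AE]; set J := invmx A0.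
exists (fun t => J *m (A1 + t *: R t) *m (J *m (A1 + t *: R t) *m invmx (A t))
                 - J *m R t *m J).
  by do ![apply: bounded0D | apply: bounded0M | apply: bounded0Z
         | apply: bounded0_cst | apply: bounded0N].
apply: near0_imp (near0_and uAt AE) => t _ [ut].
set B := invmx _; set L := A1 + _ => At.
have BE : B = J - t *: (J *m L *m B).
  apply/eqP; rewrite eq_sym subr_eq eq_sym; apply/eqP.
  have : J *m (A t *m B) = J by rewrite mulmxV// mulmx1.
  by rewrite {1}At mulmxDl mulmxDr -scalemxAl -scalemxAr mulKmx// mulmxA.
have JLJ : J *m L *m J = J *m A1 *m J + t *: (J *m R t *m J).
  by rewrite /L mulmxDr mulmxDl -scalemxAr -scalemxAl.
rewrite {1}BE {1}BE mulmxBr -scalemxAr JLJ -scalerN; congr (_ + t *: _).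
by rewrite !opprD opprK scalerBr -addrA [- (t *: _) + _]addrC.
Qed.

End Jets.

(** * Unitary curves, the first-order condition and its consequences *)

Section Calculus.
Variable C : numClosedFieldType.

(** The Cayley transform [(1 + t h) (1 - t h)^-1] is rational in [t] and replaces the exponential.
    For skew-adjoint [h] the two factors are adjoint to each other and commute, which gives
    unitarity. Each contributes [h] to the derivative, hence [h = Y / 2]. *)
Lemma jet_unitary n (Y : 'M[C]_n) : adjmx Y = - Y ->
  exists2 U : C -> 'M[C]_n, jet U 1%:M Y &
    near0 (fun t => U t *m adjmx (U t) = 1%:M).
Proof.
move=> YN; pose h := 2^-1 *: Y.
have hN : adjmx h = - h.
  by rewrite adjmxZ YN scalerN conj_Creal// rpredV realn.
have jA := jet_lin 1%:M (- h); have jB := jet_lin 1%:M h.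
exists (fun t => (1%:M + t *: h) *m invmx (1%:M + t *: - h)).
  have := jetM jB (jet_inv jA (unitmx1 _ _)).
  rewrite invmx1 !mulmx1 !mul1mx opprK -scalerDl -[2^-1]div1r -splitr scale1r.
  by [].
have [uA _] := bounded0_inv jA (unitmx1 _ _).
have [uB _] := bounded0_inv jB (unitmx1 _ _).
apply: near0_imp (near0_and uA uB) => t t0 [].
have := erefl (adjmx (1%:M + t *: h)).
rewrite {2}adjmxD adjmx1 adjmxZ hN (conj_Creal (gtr0_real t0)).
set A := 1%:M + t *: - h; set B := 1%:M + t *: h => BA uAt uBt.
have AB : A *m B = B *m A.
  rewrite /A /B !mulmxDl !mulmxDr !mul1mx !mulmx1 scalerN !mulmxN !mulNmx.
  by rewrite [_ + - (t *: h) + _]addrACA [_ + (t *: h) + _]addrACA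
    [t *: h - _]addrC.
have BAV : B *m invmx A = invmx A *m B.
  by rewrite -[LHS](mulKmx uAt) !mulmxA -[_ *m A *m B]mulmxA AB mulmxA mulmxK.
have ABadj : adjmx A = B by rewrite -BA adjmxK.
by rewrite adjmxM adjmx_inv ABadj BA {1}BAV -mulmxA mulKVmx ?mulVmx.
Qed.

Variables (m d : nat) (k : 'I_m -> nat).
Implicit Types V W : system C m d k.

Lemma jet_dP (Vt : C -> system C m d k) V V1 :
  (forall i, jet (fun t => Vt t i) (V i) (V1 i)) ->
  exists2 M, 0 <= M & near0 (fun t => dP V (Vt t) <= t * M).
Proof.
(* The induction runs on the l1 bound, which is additive in [i], unlike [dP] with its outer square
   root. *)
move=> jV; suff [M M0 HM]: exists2 M, 0 <= M &
    near0 (fun t => \sum_(i < m) mxnorm1 (V i - Vt t i) <= t * M).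
  by exists M => //; apply: near0_imp HM => t _; apply: le_trans (dP_le _ _).
elim: (index_enum _) => [|i s [M M0 IH]].
  by exists 0 => //; apply: near0_all => t _; rewrite big_nil mulr0.
have [N N0 HN] := jet_lip (jV i); exists (N + M); first exact: addr_ge0.
apply: near0_imp (near0_and HN IH) => t _ [Nt Mt].
by rewrite big_cons mulrDr lerD.
Qed.

(** Along the curve the potential changes by [t (2 D + t \tr (R t))], where [D] is the displayed sum
    of traces. If [D < 0], this is negative for small [t], while the pair stays within [eps]. The
    conclusion is a negation because the order on [C] is partial. [E] and [F] are separate
    parameters so that a curve of canonical duals can use the jet of an inverse. *)
Lemma local_min_first_order v V W (Vt Wt : C -> system C m d k) V1 W1 E F :
  local_min_FP v V W ->
  (forall i, jet (fun t => Vt t i) (V i) (V1 i)) ->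
  (forall i, jet (fun t => Wt t i) (W i) (W1 i)) ->
  jet (fun t => RSop (Vt t)) (RSop V) E ->
  jet (fun t => RSop (Wt t)) (RSop W) F ->
  near0 (fun t => in_DRS v (Vt t) (Wt t)) ->
  ~ \tr (RSop V *m E) + \tr (RSop W *m F) < 0.
Proof.
move=> [_ [eps [eps0 minFP]]] jV jW jSV jSW DRS D0.
have [M M0 HM] := jet_dP jV; have [N N0 HN] := jet_dP jW.
have [R [L L0 RL] FPE] := jetD (jetM jSV jSV) (jetM jSW jSW).
move: D0; set D := \tr _ + _ => D0.
have D2 : 0 < - D *+ 2 by rewrite pmulrn_lgt0 ?oppr_gt0.
have near_eps := near0_mul_lt (addr_ge0 M0 N0) eps0.
have near_D := near0_mul_lt L0 D2.
have [t t0 [[[[[[HMt HNt] DRSt] FPt] RLt] epst] Dt]] := near0_ex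
  (near0_and (near0_and (near0_and (near0_and (near0_and (near0_and HM HN)
     DRS) FPE) RL) near_eps) near_D).
have /(minFP _ _ DRSt) : dP V (Vt t) + dP W (Wt t) < eps.
  by apply: le_lt_trans epst; rewrite mulrDr lerD.
have FP_E V' W' : FP V' W' =
    \tr (RSop V' *m RSop V' + RSop W' *m RSop W') by rewrite mxtraceD.
rewrite !FP_E FPt [leRHS]mxtraceD lerDl mxtraceZ pmulr_rge0// mxtraceD mxtraceZ.
have -> : \tr (E *m RSop V + RSop V *m E + (F *m RSop W + RSop W *m F)) = D *+ 2.
  rewrite !mxtraceD [\tr (E *m _)]mxtrace_mulC [\tr (F *m _)]mxtrace_mulC.
  by rewrite -!mulr2n -mulrnDl.
rewrite -lerBlDl sub0r -mulNrn => DR.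
have tR0 : 0 <= t * \tr (R t) by apply: le_trans DR; apply: ltW.
suff : - D *+ 2 < - D *+ 2 by rewrite ltxx.
apply: le_lt_trans Dt; apply: le_trans DR _.
rewrite -(ger0_norm tR0) normrM (gtr0_norm t0) ler_wpM2l ?(ltW t0)//.
exact: le_trans (norm_mxtrace_le _) RLt.
Qed.

Lemma RSop_mulr V (A : 'M[C]_d) :
  RSop (fun i => V i *m A) = adjmx A *m RSop V *m A.
Proof.
rewrite mulmx_sumr mulmx_suml; apply: eq_bigr => i _.
by rewrite adjmxM !mulmxA.
Qed.

Lemma jet_RSop (Vt : C -> system C m d k) V V1 :
  (forall i, jet (fun t => Vt t i) (V i) (V1 i)) ->
  jet (fun t => RSop (Vt t)) (RSop V)
    (\sum_(i < m) (adjmx (V1 i) *m V i + adjmx (V i) *m V1 i)).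
Proof. by move=> jV; apply: jet_sum => i; apply: jetM (jV i); apply: jet_adj. Qed.

Lemma canonical_dual V : is_RS V ->
  \sum_(i < m) adjmx (V i *m invmx (RSop V)) *m V i = 1%:M.
Proof.
move=> uV; under eq_bigr do rewrite adjmxM -mulmxA.
by rewrite -mulmx_sumr adjmx_inv RSop_adj mulVmx.
Qed.

Lemma RSop_canonical_dual V : is_RS V ->
  RSop (fun i => V i *m invmx (RSop V)) = invmx (RSop V).
Proof. by move=> uV; rewrite RSop_mulr adjmx_inv RSop_adj mulVmx// mul1mx. Qed.

(* Moving [W] linearly towards the canonical dual keeps duality, and the cross
   terms of the RS operator vanish, so the potential decreases unless [Z = 0]. *)
Lemma local_min_canonical v V W : local_min_FP v V W ->
  forall i, W i = V i *m invmx (RSop V).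
Proof.
move=> locmin; have [[[uV Vv] [uW dualW]] _] := locmin.
pose Z : system C m d k := fun i => V i *m invmx (RSop V) - W i.
have ZV : \sum_(i < m) adjmx (Z i) *m V i = 0.
  under eq_bigr do rewrite adjmxD adjmxN mulmxDl mulNmx.
  by rewrite big_split sumrN /= canonical_dual// dualW subrr.
(* [W i + Z i] is [V i] times a fixed matrix, so by [ZV] its pairing with [Z] vanishes. *)
have ZW : \sum_(i < m) adjmx (Z i) *m W i = - RSop Z.
  rewrite -sumrN; apply/eqP; rewrite -subr_eq0 -sumrB.
  under eq_bigr do rewrite opprK -mulmxDr addrC subrK mulmxA.
  by rewrite -mulmx_suml ZV mul0mx.
have WZ : \sum_(i < m) adjmx (W i) *m Z i = - RSop Z.
  rewrite -[RHS]adjmxK adjmxN RSop_adj -ZW adjmx_sum.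
  by apply: eq_bigr => i _; rewrite adjmxM adjmxK.
have jW i : jet (fun t => W i + t *: Z i) (W i) (Z i) by apply: jet_lin.
pose Wt t : system C m d k := fun i => W i + t *: Z i.
have jSW := jet_RSop (Vt := Wt) jW.
have DRS : near0 (fun t => in_DRS v V (Wt t)).
  have [uWt _] := bounded0_inv jSW uW.
  apply: near0_imp uWt => t _ uWt; split=> //; split=> //.
  under eq_bigr do rewrite adjmxD adjmxZ mulmxDl -scalemxAl.
  by rewrite big_split /= dualW -scaler_sumr ZV scaler0 addr0.
have := local_min_first_order (Vt := fun=> V) locmin (fun i => jet_cst _) jW
  (jet_cst _) jSW DRS.
rewrite mulmx0 mxtrace0 add0r big_split /= ZW WZ -opprD mulmxN raddfN /= oppr_lt0.
rewrite mulmxDr mxtraceD -mulr2n pmulrn_lgt0// => ngt0 i.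
(* The first-order condition says that this trace is not positive; as a sum of squared norms it must
   be 0, term by term. *)
have trE : \tr (RSop W *m RSop Z) =
    \sum_(j < m) \sum_(l < m) frob2 (W l *m adjmx (Z j)).
  have := mxtrace_RSop_conj W Z 1%:M; rewrite adjmx1 mul1mx mulmx1 => ->.
  by under eq_bigr do under eq_bigr do rewrite mulmx1.
have frob0 j l : 0 <= frob2 (W l *m adjmx (Z j)) by apply: frob2_ge0.
have row0 j : 0 <= \sum_(l < m) frob2 (W l *m adjmx (Z j)) by apply: sumr_ge0.
have tr0 : \sum_(j < m) \sum_(l < m) frob2 (W l *m adjmx (Z j)) = 0.
  apply/eqP; move/negP: ngt0; rewrite trE lt_def => /nandP[/negPn//|].
  by rewrite sumr_ge0.
have WZ0 l : W l *m adjmx (Z i) = 0.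
  apply: frob2_eq0; have rowi : \sum_(l < m) frob2 (W l *m adjmx (Z i)) = 0.
    exact: (psumr_eq0P (fun j _ => row0 j) tr0 isT).
  exact: (psumr_eq0P (fun l _ => frob0 i l) rowi isT).
(* Summing [W l *m adjmx (Z i) = 0] against the adjoints of [W l] brings in [RSop W], which is
   invertible. *)
have : RSop W *m adjmx (Z i) = 0.
  rewrite mulmx_suml big1// => l _; by rewrite -mulmxA WZ0 mulmx0.
move/(congr1 (mulmx (invmx (RSop W)))); rewrite mulKmx// mulmx0.
move/(congr1 (@adjmx _ _ _)); rewrite adjmxK adjmx0 => /eqP.
by rewrite subr_eq0 => /eqP.
Qed.

(* [S - S^-3] is half the gradient of [tr (S^2 + S^-2)]; stationarity along the
   unitary orbits [V_i U_i] forces it to commute with each [V_i^* V_i]. *)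
Lemma local_min_gradient_comm v V W : local_min_FP v V W ->
  let J := invmx (RSop V) in
  in_commutant V (RSop V - J *m J *m J).
Proof.
move=> locmin J; set S := RSop V; set G := S - _.
have [[[uV Vv] _] _] := locmin.
have WE := local_min_canonical locmin.
have Jadj : adjmx J = J by rewrite adjmx_inv RSop_adj.
have Gadj : adjmx G = G.
  by rewrite adjmxD adjmxN !adjmxM Jadj RSop_adj mulmxA.
pose P i := adjmx (V i) *m V i.
have Padj i : adjmx (P i) = P i by rewrite adjmxM adjmxK.
(* A commutator of self-adjoint matrices is skew-adjoint, hence an admissible direction for
   [jet_unitary]. It is a descent direction: half the derivative of the potential will be minus the
   sum of the [frob2 (K i)]. *)
pose K i := G *m P i - P i *m G.
have Kadj i : adjmx (K i) = - K i.
  by rewrite adjmxD adjmxN (adjmxM G) (adjmxM (P i)) Gadj Padj opprB.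
have [U jU UU] : exists2 U : 'I_m -> C -> 'M[C]_d,
    forall i, jet (U i) 1%:M (K i) &
    forall i, near0 (fun t => U i t *m adjmx (U i t) = 1%:M).
  exact: (fin_all_exists2 (fun i => jet_unitary (Kadj i))).
pose Vt t : system C m d k := fun i => V i *m U i t.
pose Wt t : system C m d k := fun i => Vt t i *m invmx (RSop (Vt t)).
have jV i : jet (fun t => Vt t i) (V i) (V i *m K i).
  by have := jetM (jet_cst (V i)) (jU i); rewrite mul0mx add0r mulmx1.
have jSV := jet_RSop jV; set E := \sum_(i < m) _ in jSV.
have jSVI := jet_inv jSV uV.
have jW i : jet (fun t => Wt t i) (W i)
    (V i *m K i *m J + V i *m - (J *m E *m J)).
  by rewrite WE; apply: jetM (jV i) jSVI.
have [uVt _] := bounded0_inv jSV uV.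
have SW : RSop W = J.
  rewrite /J -RSop_canonical_dual//.
  by apply: eq_bigr => i _; rewrite WE.
have jSW : jet (fun t => RSop (Wt t)) (RSop W) (- (J *m E *m J)).
  rewrite SW; apply: jet_eq jSVI.
  by apply: near0_imp uVt => t _ ut; apply: RSop_canonical_dual.
have DRS : near0 (fun t => in_DRS v (Vt t) (Wt t)).
  apply: near0_imp (near0_and uVt (near0_forall_ord UU)) => t _ [ut UUt].
  split; [split=> // i | split].
  - by rewrite adjmxM mulmxA -[_ *m _ *m adjmx (U i t)]mulmxA UUt mulmx1.
  - by rewrite /is_RS RSop_canonical_dual// unitmx_inv.
  - exact: canonical_dual.
have := local_min_first_order locmin jV jW jSV jSW DRS.
have trK i : \tr (K i *m K i) = - frob2 (K i).
  by rewrite -mxtrace_mul_adj Kadj mulmxN raddfN opprK.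
have -> : \tr (RSop V *m E) + \tr (RSop W *m - (J *m E *m J)) =
    - \sum_(i < m) frob2 (K i).
  (* By cyclicity both traces combine into [\tr (G *m E)]. *)
  rewrite SW mulmxN raddfN /= !mulmxA [\tr (_ *m J)]mxtrace_mulC.
  rewrite !mulmxA -raddfB -mulmxBl.
  rewrite -/S -/G mulmx_sumr raddf_sum -sumrN; apply: eq_bigr => i _ /=.
  have -> : adjmx (V i *m K i) *m V i + adjmx (V i) *m (V i *m K i) =
      P i *m K i - K i *m P i.
    rewrite adjmxM Kadj -mulmxA mulNmx [adjmx (V i) *m (V i *m _)]mulmxA.
    by rewrite addrC.
  rewrite -trK mulmxBr raddfB /= mulmxA.
  rewrite [\tr (G *m (_ *m _))]mxtrace_mulC -[_ *m P i *m G]mulmxA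
    [\tr (_ *m (_ *m G))]mxtrace_mulC.
  by rewrite -raddfB -mulmxBl.
rewrite oppr_lt0 => ngt0 i; apply/eqP; rewrite -subr_eq0; apply/eqP.
have sum0 : \sum_(j < m) frob2 (K j) = 0.
  apply/eqP; move/negP: ngt0; rewrite lt_def => /nandP[/negPn//|].
  by rewrite sumr_ge0// => j _; apply: frob2_ge0.
exact: frob2_eq0 (psumr_eq0P (fun j _ => frob2_ge0 (K j)) sum0 isT).
Qed.

(* With [M := S A - A S], the hypothesis reads [M = S^-3 A - A S^-3]; hence
   [S^3 M S^3 + S^2 M + S M S + M S^2 = 0], and pairing with [M] yields a
   vanishing sum of nonnegative terms. *)
Lemma comm_of_gradient_comm V (A : 'M[C]_d) : is_RS V -> adjmx A = A ->
  let S := RSop V in let J := invmx S in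
  (S - J *m J *m J) *m A = A *m (S - J *m J *m J) -> S *m A = A *m S.
Proof.
move=> uV Aadj S J GA; have Sadj : adjmx S = S by apply: RSop_adj.
pose M := S *m A - A *m S; pose T := S *m S *m S.
have Madj : adjmx M = - M by rewrite adjmxD adjmxN !adjmxM Aadj Sadj opprB.
pose J3 := J *m J *m J.
have ME : M = J3 *m A - A *m J3.
  move: GA; rewrite mulmxBl mulmxBr => /eqP; rewrite subr_eq => /eqP SA.
  by rewrite /M SA addrC -addrA addKr addrC.
have TJ : T *m J3 = 1%:M by rewrite /J3 !mulmxA !mulmxK// mulmxV.
have JT : J3 *m T = 1%:M by apply: mulmx1C.
have TMT : T *m M *m T = A *m T - T *m A.
  rewrite ME mulmxBr mulmxBl [T *m (J3 *m _)]mulmxA TJ mul1mx.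
  by rewrite -[T *m _ *m T]mulmxA -[A *m J3 *m T]mulmxA JT mulmx1.
(* The Leibniz rule for the commutator with [A], applied to the cube of [S]; the sum telescopes. *)
have TE : T *m A - A *m T = S *m S *m M + S *m M *m S + M *m S *m S.
  rewrite /M /T !mulmxBr !mulmxBl !mulmxA.
  by rewrite !subrKA.
(* Exhibiting the cube of [S] as an RS operator makes [mxtrace_RSop_conj] applicable to it. *)
have TS : T = RSop (fun i => V i *m S) by rewrite RSop_mulr Sadj.
have MS : M = S *m A - A *m S by [].
clearbody T M.
have pos1 : 0 <= \tr (adjmx M *m T *m M *m T).
  rewrite TS mxtrace_RSop_conj; do 2!apply: sumr_ge0 => ? _.
  exact: frob2_ge0.
have pos2 : 0 <= \tr (adjmx M *m S *m M *m S).
  by rewrite mxtrace_RSop_conj; do 2!apply: sumr_ge0 => ? _; apply: frob2_ge0.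
have pos3 : \tr (adjmx M *m S *m S *m M) = frob2 (adjmx M *m S).
  by rewrite -mxtrace_mul_adj adjmxM adjmxK Sadj !mulmxA.
have pos4 : \tr (adjmx M *m M *m S *m S) = frob2 (S *m adjmx M).
  by rewrite mxtrace_mulC !mulmxA -mxtrace_mul_adj adjmxM adjmxK Sadj !mulmxA.
have : \tr (adjmx M *m (T *m M *m T + (T *m A - A *m T))) = 0.
  by rewrite TMT -opprB addNr mulmx0 mxtrace0.
rewrite TE !mulmxDr !mxtraceD !mulmxA pos3 pos4 => /eqP.
rewrite paddr_eq0 ?addr_ge0 ?frob2_ge0// => /andP[_].
rewrite paddr_eq0 ?addr_ge0 ?frob2_ge0// => /andP[/[swap] _].
(* This extracts [adjmx M *m S = 0]; cancelling the invertible [S] gives [M = 0]. *)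
rewrite paddr_eq0 ?frob2_ge0// => /andP[/eqP/frob2_eq0 + _].
move/(congr1 (mulmx^~ J)); rewrite mulmxK// mul0mx Madj MS => /eqP.
by rewrite oppr_eq0 subr_eq0 => /eqP.
Qed.

(** Since [A] commutes with [S], it preserves the kernel of [S], so [P A P = A P]. The left side is
    self-adjoint, so taking adjoints gives [P A P = P A] as well. *)
Lemma comm_orth_proj n (S P A : 'M[C]_n) : adjmx A = A ->
  orth_proj_onto_ker S P -> S *m A = A *m S -> P *m A = A *m P.
Proof.
move=> Aadj [PP [Padj kerP]] SA.
(* The kernel condition on vectors is extended column by column, to be applied to [P] and
   [A *m P]. *)
have kerP_mx q (B : 'M[C]_(n, q)) : S *m B = 0 <-> P *m B = B.
  have mul_col X j : X *m col j B = col j (X *m B) by rewrite !colE mulmxA.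
  split=> eqB; apply/trmx_inj/row_matrixP => j; rewrite -!tr_col -mul_col.
    by congr _^T; apply/kerP; rewrite mul_col eqB col0.
  by congr _^T; rewrite col0; apply/kerP; rewrite mul_col eqB.
have SP : S *m P = 0 by apply/kerP_mx.
have PAP : P *m (A *m P) = A *m P.
  by apply/kerP_mx; rewrite mulmxA SA -mulmxA SP mulmx0.
have APadj : adjmx (A *m P) = P *m A by rewrite adjmxM Padj Aadj.
by rewrite -APadj -{1}PAP adjmxM APadj Padj -mulmxA.
Qed.

End Calculus.

Theorem theorem6p6 (C : numClosedFieldType) (m d : nat) (k : 'I_m -> nat)
    (hm : (0 < m)%N) (hd : (0 < d)%N)
    (hk : forall i : 'I_m, (0 < k i <= d)%N)
    (v : 'I_m -> C) (hv : forall i : 'I_m, 0 < v i)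
    (V W : system C m d k) :
  local_min_FP v V W ->
  in_commutant V (RSop V) /\
  (forall (sigma : C) (P : 'M[C]_d),
     eigenvalue (RSop V) sigma ->
     orth_proj_onto_ker (RSop V - sigma%:M) P ->
     in_commutant V P).
Proof.
move=> locmin; have [[[uV _] _] _] := locmin.
have Aadj i : adjmx (adjmx (V i) *m V i) = adjmx (V i) *m V i.
  by rewrite adjmxM adjmxK.
have commS : in_commutant V (RSop V).
  move=> i; apply: comm_of_gradient_comm => //.
  exact: local_min_gradient_comm locmin i.
split=> // sigma P _ projP i; apply: (comm_orth_proj _ projP) => //.
by rewrite mulmxBl mulmxBr commS scalar_mxC.
Qed.
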